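(* Let $\Gamma$ be a finite group and $0\to B'\xrightarrow{\iota}B\xrightarrow{\varkappa}B''\to0$ a short exact sequence of $\Gamma$-modules. Then there is a long exact sequence $$\cdots\xrightarrow{\delta_2}H_1(\Gamma,B')\to H_1(\Gamma,B)\to H_1(\Gamma,B'')\xrightarrow{\delta_1}(B')_{\Gamma,\mathrm{tors}}\to B_{\Gamma,\mathrm{tors}}\to(B'')_{\Gamma,\mathrm{tors}}\xrightarrow{\delta_0}(B'\otimes\mathbb{Q}/\mathbb{Z})_\Gamma\to(B\otimes\mathbb{Q}/\mathbb{Z})_\Gamma\to(B''\otimes\mathbb{Q}/\mathbb{Z})_\Gamma\to0,$$ in which the non-connecting maps are induced by $\iota$ and $\varkappa$, continuing to the left with the homology groups $H_m(\Gamma,\cdot)$, and depending functorially on $\Gamma$ and on the short exact sequence.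
   Context: $H_m(\Gamma,\cdot)$ is group homology, subscript $\Gamma$ denotes coinvariants, and $A_{\Gamma,\mathrm{tors}}$ is the torsion subgroup of $A_\Gamma$; tensor products are over $\mathbb{Z}$ with trivial action on $\mathbb{Q}/\mathbb{Z}$. *)

(* Defs.v *)
From HB Require Import structures.
From mathcomp Require Import all_boot all_order all_algebra all_fingroup.
From mathcomp Require Import generic_quotient ring_quotient.
From mathcomp Require Import boolp.
From mathcomp Require Import freeg.

Set Implicit Arguments.
Unset Strict Implicit.
Unset Printing Implicit Defensive.

Import GRing.Theory.

Local Open Scope ring_scope.
Local Open Scope quotient_scope.

Section GeneratedSubgroup.
Variables (V : zmodType) (S : V -> Prop).

Definition gen : {pred V} :=
  fun x => `[< forall I : zmodClosed V, (forall y, S y -> y \in I) -> x \in I >].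

Lemma genP x :
  reflect (forall I : zmodClosed V, (forall y, S y -> y \in I) -> x \in I)
          (x \in gen).
Proof. exact: asboolP. Qed.

Lemma gen_zmod_closed : zmod_closed gen.
Proof.
split=> [|x y /genP xG /genP yG]; apply/genP => I SI; first exact: rpred0.
by rewrite rpredB ?xG ?yG.
Qed.

HB.instance Definition _ := GRing.isZmodClosed.Build V gen gen_zmod_closed.

Lemma mem_gen x : S x -> x \in gen.
Proof. by move=> Sx; apply/genP => I; apply. Qed.

Definition zquot : zmodType := Quotient.quot gen.

Definition zpi (x : V) : zquot := \pi_(Quotient.quot gen) x.

Lemma zpi_is_zmod_morphism : zmod_morphism zpi.
Proof. by move=> x y; rewrite /zpi !piE. Qed.

HB.instance Definition _ :=
  GRing.isZmodMorphism.Build V zquot zpi zpi_is_zmod_morphism.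

Lemma zpi_eq0 x : (zpi x == 0) = (x \in gen).
Proof.
by rewrite -[0](raddf0 zpi) /zpi -Quotient.idealrBE subr0.
Qed.

Lemma zpi_surj (q : zquot) : exists x, q = zpi x.
Proof. by exists (repr q); rewrite /zpi reprK. Qed.

Section Lift.
Variables (W : zmodType) (f : {additive V -> W}).

Definition zlift of (forall x, S x -> f x = 0) : zquot -> W :=
  fun q => f (repr q).

Hypothesis f0 : forall x, S x -> f x = 0.

Lemma zliftE x : zlift f0 (zpi x) = f x.
Proof.
apply/eqP; rewrite /zlift -subr_eq0 -raddfB.
pose K : {pred V} := fun y => f y == 0.
have K_closed : zmod_closed K.
  split=> [|y z]; rewrite /in_mem /= /K; first by rewrite raddf0.
  by move=> /eqP fy /eqP fz; rewrite raddfB fy fz subr0.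
pose Ki := GRing.isZmodClosed.Build V K K_closed.
pose KZ : zmodClosed V := HB.pack K Ki.
suff /genP/(_ KZ) : repr (zpi x) - x \in gen.
  by apply=> y /f0 fy; rewrite /in_mem /= /K fy.
rewrite -zpi_eq0 raddfB subr_eq0; apply/eqP.
exact: (reprK (zpi x : Quotient.quot gen)).
Qed.

Lemma zlift_is_zmod_morphism : zmod_morphism (zlift f0).
Proof.
move=> p q; have [x ->] := zpi_surj p; have [y ->] := zpi_surj q.
by rewrite -raddfB !zliftE raddfB.
Qed.

HB.instance Definition _ :=
  GRing.isZmodMorphism.Build zquot W (zlift f0) zlift_is_zmod_morphism.

End Lift.
End GeneratedSubgroup.
(* Keeps [simpl] from unfolding quotients to representatives. *)
Opaque zquot zpi zlift.

Section QuotientMap.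
Variables (V W : zmodType) (S : V -> Prop) (T : W -> Prop).
Variable f : {additive V -> W}.
Hypothesis fST : forall x, S x -> f x \in gen T.

Lemma zmap_subproof x : S x -> (zpi T \o f) x = 0.
Proof. by move=> Sx; apply/eqP; rewrite /= zpi_eq0 fST. Qed.

Definition zmap : {additive zquot S -> zquot T} := zlift zmap_subproof.

Lemma zmapE x : zmap (zpi S x) = zpi T (f x).
Proof. exact: zliftE. Qed.

End QuotientMap.
Opaque zmap.

Section Subgroup.
Variables (V : zmodType) (I : zmodClosed V).

Definition zsub := {x : V | x \in I}.

HB.instance Definition _ := SubChoice.on zsub.
HB.instance Definition _ := [SubChoice_isSubZmodule of zsub by <:].

End Subgroup.

Section SubgroupMap.
Variables (V W : zmodType) (I : zmodClosed V) (J : zmodClosed W).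
Variable f : {additive V -> W}.
Hypothesis fIJ : forall x, x \in I -> f x \in J.

Definition zrestr_fun (x : zsub I) : zsub J := exist _ (f (val x)) (fIJ (valP x)).

Lemma zrestr_is_zmod_morphism : zmod_morphism zrestr_fun.
Proof. by move=> x y; apply: val_inj; rewrite /= !raddfB. Qed.

HB.instance Definition _ := GRing.isZmodMorphism.Build (zsub I) (zsub J)
  zrestr_fun zrestr_is_zmod_morphism.

Definition zrestr : {additive zsub I -> zsub J} := zrestr_fun.

End SubgroupMap.

Section Kernel.
Variables (V W : zmodType) (f : {additive V -> W}).

Definition zker : {pred V} := [pred x | f x == 0].

Lemma zker_zmod_closed : zmod_closed zker.
Proof.
split=> [|x y]; rewrite !inE ?raddf0 // => /eqP fx /eqP fy.
by rewrite raddfB fx fy subr0.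
Qed.

HB.instance Definition _ := GRing.isZmodClosed.Build V zker zker_zmod_closed.

End Kernel.

Section Torsion.
Variable V : zmodType.

Definition torsion : {pred V} := fun x => `[< exists n, (0 < n)%N /\ x *+ n = 0 >].

Lemma torsion_zmod_closed : zmod_closed torsion.
Proof.
split=> [|x y /asboolP[m [m0 xm]] /asboolP[n [n0 yn]]]; apply/asboolP.
  by exists 1%N; rewrite mul0rn.
exists (m * n)%N; rewrite muln_gt0 m0 n0; split=> //.
by rewrite mulrnBl mulrnA xm mul0rn sub0r mulnC mulrnA yn mul0rn oppr0.
Qed.

HB.instance Definition _ := GRing.isZmodClosed.Build V torsion torsion_zmod_closed.

End Torsion.
Arguments torsion : clear implicits.

Definition tors (V : zmodType) : zmodType := zsub (torsion V).

Lemma torsion_map_subproof (V W : zmodType) (f : {additive V -> W}) x :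
  x \in torsion V -> f x \in torsion W.
Proof.
move=> /asboolP[n [n0 xn]]; apply/asboolP; exists n; split=> //.
by rewrite -raddfMn xn raddf0.
Qed.

Definition tors_map (V W : zmodType) (f : {additive V -> W}) :
  {additive tors V -> tors W} := zrestr (@torsion_map_subproof V W f).

Section Tensor.
Variables U V : zmodType.

Variant bilinear_rel : {freeg (U * V) / int} -> Prop :=
| BilinearL u1 u2 v :
    bilinear_rel (<< (u1 + u2, v) >> - << (u1, v) >> - << (u2, v) >>)
| BilinearR u v1 v2 :
    bilinear_rel (<< (u, v1 + v2) >> - << (u, v1) >> - << (u, v2) >>).

Definition tens : zmodType := zquot bilinear_rel.

Definition tpure (u : U) (v : V) : tens := zpi bilinear_rel << (u, v) >>.

End Tensor.

HB.instance Definition _ (K : choiceType) (M : lmodType int) (f : K -> M) :=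
  GRing.isZmodMorphism.Build {freeg K / int} M (fglift f) (lift_is_additive f).

Definition free_map (K L : choiceType) (h : K -> L) :
  {additive {freeg K / int} -> {freeg L / int}} :=
  fglift (fun k => << h k >> : {freeg L / int}).

Lemma free_mapU (K L : choiceType) (h : K -> L) k :
  free_map h << k >> = << h k >>.
Proof. by rewrite /free_map /= liftU scale1r. Qed.

Section TensorMap.
Variables (U U' V : zmodType) (f : {additive U -> U'}).

Lemma tens_map_subproof x : bilinear_rel x ->
  free_map (fun p : U * V => (f p.1, p.2)) x \in gen (@bilinear_rel U' V).
Proof.
case=> *; rewrite !raddfB /= !free_mapU /= ?raddfD; apply: mem_gen.
  exact: BilinearL.
exact: BilinearR.
Qed.

Definition tens_map : {additive tens U V -> tens U' V} := zmap tens_map_subproof.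

Lemma tens_mapE u v : tens_map (tpure u v) = tpure (f u) v.
Proof. by rewrite /tens_map /tpure zmapE free_mapU. Qed.

End TensorMap.

Lemma freeg_additive_eq (K : choiceType) (M : zmodType)
    (f g : {additive {freeg K / int} -> M}) :
  (forall k, f << k >> = g << k >>) -> f =1 g.
Proof.
move=> fg D; rewrite -(freeg_sumE D) !raddf_sum; apply: eq_bigr => k _ /=.
by rewrite -[coeff k D]intz -freegU_mulz !raddfMz fg.
Qed.

Lemma zquot_additive_eq (V M : zmodType) (S : V -> Prop)
    (f g : {additive zquot S -> M}) :
  (forall x, f (zpi S x) = g (zpi S x)) -> f =1 g.
Proof. by move=> fg q; have [x ->] := zpi_surj q. Qed.

Lemma tens_additive_eq (U V M : zmodType) (f g : {additive tens U V -> M}) :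
  (forall u v, f (tpure u v) = g (tpure u v)) -> f =1 g.
Proof.
move=> fg; apply: (@zquot_additive_eq _ _ (@bilinear_rel U V) f g) => x.
apply: (@freeg_additive_eq _ _ (f \o zpi _) (g \o zpi _)) => -[u v].
exact: fg.
Qed.

Definition QmodZ : zmodType := zquot (fun x : rat => exists n : int, x = n%:~R).

Record gmod (G : finGroupType) := GMod {
  gmod_sort :> zmodType;
  act : G -> {additive gmod_sort -> gmod_sort};
  act1 : forall a, act 1%g a = a;
  actM : forall g h a, act (g * h)%g a = act g (act h a)
}.

(* A homomorphism of modules along a group homomorphism [phi]; for
   [phi = idfun] these are the G-linear maps. *)
Record gmor (G H : finGroupType) (phi : {multiplicative G -> H})
    (A : gmod G) (C : gmod H) := GMor {
  gmor_fun :> {additive A -> C};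
  gmorJ : forall g a, gmor_fun (act A g a) = act C (phi g) (gmor_fun a)
}.

Definition glin (G : finGroupType) (A C : gmod G) := @gmor G G idfun A C.

Definition gmor_id (G : finGroupType) (A : gmod G) : glin A A :=
  @GMor G G idfun A A idfun (fun _ _ => erefl).

Section GmorComp.
Variables (G H K : finGroupType).
Variables (phi : {multiplicative G -> H}) (psi : {multiplicative H -> K}).
Variables (A : gmod G) (C : gmod H) (D : gmod K).
Variables (f : gmor phi A C) (h : gmor psi C D).

Lemma gmor_comp_subproof g a : (h \o f) (act A g a) = act D ((psi \o phi) g) ((h \o f) a).
Proof. by rewrite /= !gmorJ. Qed.

Definition gmor_comp : gmor (psi \o phi) A D := GMor gmor_comp_subproof.

End GmorComp.

Section Coinvariants.
Variables (G : finGroupType) (A : gmod G).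

Definition coinv_rel (x : A) : Prop := exists g a, x = act A g a - a.

Definition coinv : zmodType := zquot coinv_rel.

End Coinvariants.

Definition ctors (G : finGroupType) (A : gmod G) : zmodType := tors (coinv A).

Section CoinvariantsMap.
Variables (G H : finGroupType) (phi : {multiplicative G -> H}).
Variables (A : gmod G) (C : gmod H) (f : gmor phi A C).

Lemma coinv_map_subproof x : coinv_rel x -> f x \in gen (@coinv_rel H C).
Proof.
case=> g [a ->]; rewrite raddfB gmorJ; apply: mem_gen.
by exists (phi g), (f a).
Qed.

Definition coinv_map : {additive coinv A -> coinv C} := zmap coinv_map_subproof.

Definition ctors_map : {additive ctors A -> ctors C} := tors_map coinv_map.

End CoinvariantsMap.

Section TensorQmodZ.
Variables (G : finGroupType) (A : gmod G).

Lemma tensQZ_act1 x : tens_map QmodZ (act A 1%g) x = x.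
Proof.
apply: (@tens_additive_eq _ _ _ _ idfun) => u v.
by rewrite (tens_mapE (act A 1%g)) act1.
Qed.

Lemma tensQZ_actM g h x :
  tens_map QmodZ (act A (g * h)%g) x =
  tens_map QmodZ (act A g) (tens_map QmodZ (act A h) x).
Proof.
apply: (@tens_additive_eq _ _ _ _ (tens_map _ (act A g) \o tens_map _ (act A h))).
move=> u v; rewrite /= (tens_mapE (act A (g * h)%g)) (tens_mapE (act A h)).
by rewrite (tens_mapE (act A g)) actM.
Qed.

Definition tensQZ : gmod G := GMod tensQZ_act1 tensQZ_actM.

End TensorQmodZ.

Section TensorQmodZMap.
Variables (G H : finGroupType) (phi : {multiplicative G -> H}).
Variables (A : gmod G) (C : gmod H) (f : gmor phi A C).

Lemma tensQZ_map_subproof g (x : tensQZ A) :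
  tens_map QmodZ f (act (tensQZ A) g x) =
  act (tensQZ C) (phi g) (tens_map QmodZ f x).
Proof.
apply: (@tens_additive_eq _ _ _ (tens_map _ f \o act (tensQZ A) g)
  (act (tensQZ C) (phi g) \o tens_map _ f)) => u v.
rewrite /= (tens_mapE (act A g)) !(tens_mapE f).
by rewrite (tens_mapE (act C (phi g))) gmorJ.
Qed.

Definition tensQZ_map : gmor phi (tensQZ A) (tensQZ C) :=
  @GMor G H phi (tensQZ A) (tensQZ C) (tens_map QmodZ f) tensQZ_map_subproof.

End TensorQmodZMap.

Section BarComplex.
Variables (G : finGroupType) (A : gmod G).

(* The chain [c] stands for the sum of the [c g (x) [g_0 | ... | g_(m-1)]]
   in the inhomogeneous bar complex. *)
Definition chain (m : nat) : zmodType := {ffun {ffun 'I_m -> G} -> A}.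

(* [i = 0] drops the first entry, [i = m.+1] drops the last one, and any other
   [i] multiplies the entries of index [i.-1] and [i]. *)
Definition bar_face m (i : 'I_m.+2) (g : {ffun 'I_m.+1 -> G}) : {ffun 'I_m -> G} :=
  [ffun k : 'I_m =>
    if (k.+1 < i)%N then g (widen_ord (leqnSn m) k)
    else if k.+1 == i :> nat then (g (widen_ord (leqnSn m) k) * g (fintype.lift ord0 k))%g
    else g (fintype.lift ord0 k)].

(* A left module is a right module via [a g = g^-1 a], so that
   [a (x) g_0 [g_1 | ...] = (g_0^-1 a) (x) [g_1 | ...]]. *)
Definition bar_coef m (i : 'I_m.+2) (g : {ffun 'I_m.+1 -> G}) (a : A) : A :=
  if i == ord0 then act A (g ord0)^-1%g a else a.

Definition bar_bdS m (c : chain m.+1) : chain m :=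
  [ffun t => \sum_(i < m.+2) \sum_(g | bar_face i g == t)
                bar_coef i g (c g) *~ (-1) ^+ i].

Definition bar_bd m : chain m -> chain m.-1 :=
  if m is n.+1 then @bar_bdS n else fun=> 0.

Lemma bar_coefB m i g : {morph @bar_coef m i g : a b / a - b}.
Proof. by move=> a b; rewrite /bar_coef; case: ifP; rewrite ?raddfB. Qed.

Lemma bar_bd_is_zmod_morphism m : zmod_morphism (@bar_bd m).
Proof.
case: m => [|m] c d; first by rewrite subr0.
apply/ffunP => t; rewrite !ffunE -sumrB; apply: eq_bigr => i _.
rewrite -sumrB; apply: eq_bigr => g _.
by rewrite !ffunE bar_coefB mulrzBl.
Qed.

HB.instance Definition _ m :=
  GRing.isZmodMorphism.Build (chain m) (chain m.-1) (@bar_bd m)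
    (@bar_bd_is_zmod_morphism m).

Definition cycle (m : nat) : zmodType := zsub (zker (@bar_bd m)).

Definition boundary m (z : cycle m) : Prop :=
  exists c : chain m.+1, val z = bar_bd c.

Definition Hgrp (m : nat) : zmodType := zquot (@boundary m).

End BarComplex.

Section HomologyMap.
Variables (G H : finGroupType) (phi : {multiplicative G -> H}).
Variables (A : gmod G) (C : gmod H) (f : gmor phi A C).

Definition simplex_map m (g : {ffun 'I_m -> G}) : {ffun 'I_m -> H} :=
  [ffun k => phi (g k)].

Definition chain_map m (c : chain A m) : chain C m :=
  [ffun t => \sum_(g | simplex_map g == t) f (c g)].

Lemma chain_map_is_zmod_morphism m : zmod_morphism (@chain_map m).
Proof.
move=> c d; apply/ffunP => t; rewrite !ffunE -sumrB.
by apply: eq_bigr => g _; rewrite !ffunE raddfB.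
Qed.

HB.instance Definition _ m :=
  GRing.isZmodMorphism.Build (chain A m) (chain C m) (@chain_map m)
    (@chain_map_is_zmod_morphism m).

Lemma bar_face_map m (i : 'I_m.+2) g :
  bar_face i (simplex_map g) = simplex_map (bar_face i g).
Proof.
by apply/ffunP => k; rewrite !ffunE; case: ifP => // _; case: ifP => // _; rewrite gmulfM.
Qed.

Lemma multiplicativeV x : phi x^-1%g = (phi x)^-1%g.
Proof.
have phi1 : phi 1%g = 1%g.
  by apply: (mulgI (phi 1%g)); rewrite -gmulfM !mulg1.
by apply: (mulgI (phi x)); rewrite -gmulfM !mulgV.
Qed.

Lemma bar_coef_map m (i : 'I_m.+2) g a :
  bar_coef i (simplex_map g) (f a) = f (bar_coef i g a).
Proof.
by rewrite /bar_coef; case: ifP => // _; rewrite gmorJ ffunE multiplicativeV.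
Qed.

Lemma sum_fiber (I J : finType) (V : zmodType) (p : I -> J) (Q : pred J) (F : I -> V) :
  \sum_(j | Q j) \sum_(i | p i == j) F i = \sum_(i | Q (p i)) F i.
Proof.
rewrite [RHS](partition_big p Q) //; apply: eq_bigr => j Qj.
by apply: eq_bigl => i; case: eqP => [->|]; rewrite ?Qj ?andbF.
Qed.

Lemma bar_bd_map m (c : chain A m) : bar_bd (chain_map c) = chain_map (bar_bd c).
Proof.
case: m c => [|m] c; first by rewrite /= raddf0.
apply/ffunP => t; rewrite !ffunE.
under [RHS]eq_bigr => s _ do rewrite ffunE raddf_sum.
rewrite exchange_big /=; apply: eq_bigr => i _.
under [RHS]eq_bigr => s _ do rewrite raddf_sum.
rewrite (sum_fiber (bar_face i) (fun s => simplex_map s == t)).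
pose K g := f (bar_coef i g (c g) *~ (-1) ^+ i).
transitivity (\sum_(h | bar_face i h == t) \sum_(g | simplex_map g == h) K g).
  apply: eq_bigr => h _; rewrite ffunE.
  have -> : bar_coef i h (\sum_(g | simplex_map g == h) f (c g)) =
            \sum_(g | simplex_map g == h) bar_coef i h (f (c g)).
    by rewrite /bar_coef; case: ifP => // _; rewrite raddf_sum.
  rewrite mulrz_suml; apply: eq_bigr => g /eqP <-.
  by rewrite /K raddfMz bar_coef_map.
rewrite sum_fiber; apply: eq_bigl => g.
by rewrite bar_face_map.
Qed.

Lemma cycle_map_subproof m (c : chain A m) :
  c \in zker (@bar_bd G A m) -> chain_map c \in zker (@bar_bd H C m).
Proof.
rewrite !inE => /eqP dc.
by rewrite [X in X == 0]bar_bd_map [X in chain_map X]dc raddf0.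
Qed.

Definition cycle_map m : {additive cycle A m -> cycle C m} :=
  zrestr (@cycle_map_subproof m).

Lemma boundary_map m (z : cycle A m) :
  boundary z -> cycle_map m z \in gen (@boundary H C m).
Proof.
case=> c zc; apply: mem_gen; exists (chain_map c).
by rewrite bar_bd_map -zc.
Qed.

Definition Hmap m : {additive Hgrp A m -> Hgrp C m} := zmap (@boundary_map m).

End HomologyMap.

Definition exact_at (U V W : zmodType) (f : U -> V) (g : V -> W) : Prop :=
  forall v, g v = 0 <-> exists u, v = f u.

Record ses (G : finGroupType) := SES {
  ses_sub : gmod G;
  ses_mid : gmod G;
  ses_quo : gmod G;
  ses_inj : glin ses_sub ses_mid;
  ses_proj : glin ses_mid ses_quo;
  ses_injective : injective ses_inj;
  ses_exact : exact_at ses_inj ses_proj;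
  ses_surjective : forall b, exists a, b = ses_proj a
}.

Record ses_mor (G H : finGroupType) (phi : {multiplicative G -> H})
    (S : ses G) (T : ses H) := SESMor {
  mor_sub : gmor phi (ses_sub S) (ses_sub T);
  mor_mid : gmor phi (ses_mid S) (ses_mid T);
  mor_quo : gmor phi (ses_quo S) (ses_quo T);
  mor_inj : forall a, mor_mid (ses_inj S a) = ses_inj T (mor_sub a);
  mor_proj : forall a, mor_quo (ses_proj S a) = ses_proj T (mor_mid a)
}.

(* [connH m] is the map usually denoted by delta_(m+2). *)
Record connecting (G : finGroupType) (S : ses G) := Connecting {
  connH : forall m, {additive Hgrp (ses_quo S) m.+2 -> Hgrp (ses_sub S) m.+1};
  conn1 : {additive Hgrp (ses_quo S) 1 -> ctors (ses_sub S)};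
  conn0 : {additive ctors (ses_quo S) -> coinv (tensQZ (ses_sub S))}
}.

Record long_exact (G : finGroupType) (S : ses G) (d : connecting S) : Prop := {
  exact_H_sub : forall m, exact_at (connH d m) (Hmap (ses_inj S) m.+1);
  exact_H_mid : forall m, exact_at (Hmap (ses_inj S) m.+1) (Hmap (ses_proj S) m.+1);
  exact_H_quo : forall m, exact_at (Hmap (ses_proj S) m.+2) (connH d m);
  exact_H1_quo : exact_at (Hmap (ses_proj S) 1) (conn1 d);
  exact_ctors_sub : exact_at (conn1 d) (ctors_map (ses_inj S));
  exact_ctors_mid : exact_at (ctors_map (ses_inj S)) (ctors_map (ses_proj S));
  exact_ctors_quo : exact_at (ctors_map (ses_proj S)) (conn0 d);
  exact_tens_sub : exact_at (conn0 d) (coinv_map (tensQZ_map (ses_inj S)));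
  exact_tens_mid : exact_at (coinv_map (tensQZ_map (ses_inj S)))
                            (coinv_map (tensQZ_map (ses_proj S)));
  exact_tens_quo : forall y, exists x, y = coinv_map (tensQZ_map (ses_proj S)) x
}.

Record ladder (G H : finGroupType) (phi : {multiplicative G -> H})
    (S : ses G) (T : ses H) (F : ses_mor phi S T)
    (d : connecting S) (e : connecting T) : Prop := {
  ladder_H_inj : forall m x,
    Hmap (mor_mid F) m.+1 (Hmap (ses_inj S) m.+1 x) =
    Hmap (ses_inj T) m.+1 (Hmap (mor_sub F) m.+1 x);
  ladder_H_proj : forall m x,
    Hmap (mor_quo F) m.+1 (Hmap (ses_proj S) m.+1 x) =
    Hmap (ses_proj T) m.+1 (Hmap (mor_mid F) m.+1 x);
  ladder_connH : forall m x,
    Hmap (mor_sub F) m.+1 (connH d m x) = connH e m (Hmap (mor_quo F) m.+2 x);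
  ladder_conn1 : forall x,
    ctors_map (mor_sub F) (conn1 d x) = conn1 e (Hmap (mor_quo F) 1 x);
  ladder_ctors_inj : forall x,
    ctors_map (mor_mid F) (ctors_map (ses_inj S) x) =
    ctors_map (ses_inj T) (ctors_map (mor_sub F) x);
  ladder_ctors_proj : forall x,
    ctors_map (mor_quo F) (ctors_map (ses_proj S) x) =
    ctors_map (ses_proj T) (ctors_map (mor_mid F) x);
  ladder_conn0 : forall x,
    coinv_map (tensQZ_map (mor_sub F)) (conn0 d x) =
    conn0 e (ctors_map (mor_quo F) x);
  ladder_tens_inj : forall x,
    coinv_map (tensQZ_map (mor_mid F)) (coinv_map (tensQZ_map (ses_inj S)) x) =
    coinv_map (tensQZ_map (ses_inj T)) (coinv_map (tensQZ_map (mor_sub F)) x);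
  ladder_tens_proj : forall x,
    coinv_map (tensQZ_map (mor_quo F)) (coinv_map (tensQZ_map (ses_proj S)) x) =
    coinv_map (tensQZ_map (ses_proj T)) (coinv_map (tensQZ_map (mor_mid F)) x)
}.

(* [T] together with [tmap] is a functor on the category of pairs (G, A), whose
   morphisms (G, A) -> (H, C) are the pairs (phi, f). *)
Definition functor_laws (T : forall G : finGroupType, gmod G -> zmodType)
    (tmap : forall (G H : finGroupType) (phi : {multiplicative G -> H})
      (A : gmod G) (C : gmod H), gmor phi A C -> {additive T G A -> T H C}) :
    Prop :=
  (forall (G : finGroupType) (A : gmod G) x,
     tmap G G idfun A A (gmor_id A) x = x) /\
  (forall (G H K : finGroupType) (phi : {multiplicative G -> H})
      (psi : {multiplicative H -> K}) (A : gmod G) (C : gmod H) (D : gmod K)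
      (f : gmor phi A C) (h : gmor psi C D) x,
     tmap G K (psi \o phi) A D (gmor_comp f h) x =
     tmap H K psi C D h (tmap G H phi A C f x)).
Arguments functor_laws : clear implicits.

(* Main.v *)
Require Import Defs.
From HB Require Import structures.
From mathcomp Require Import all_boot all_order all_algebra all_fingroup.
From mathcomp Require Import boolp freeg zify ring.
Import Defs.

(** The homology sequence of the bar complex ends in
    [H_1(B'') -> B'_G -> B_G -> B''_G -> 0].  The norm map shows that
    [B'_G -> B_G] has torsion kernel, so the sequence stays exact on torsion
    subgroups up to [(B'')_{G,tors}].  Every element of [(B (x) Q/Z)_G] is the
    class of some [a (x) 1/n] with [a] in [B_G], and it vanishes exactly when [a]
    lies in [n B_G] plus torsion; this makes the remaining terms a snake-type
    computation, with [delta_0 x] the class of [a' (x) 1/n] where [n x = 0],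
    [a] lifts [x] and [iota a' = n a].  All connecting maps are obtained from
    additive relations, which makes naturality immediate. *)

Set Implicit Arguments.
Unset Strict Implicit.
Unset Printing Implicit Defensive.

Import GRing.Theory Num.Theory.

Local Open Scope ring_scope.

(* Keeps [/=] from unfolding quotients to representatives. *)
Opaque zquot zpi zlift zmap.

Lemma gen_ind (V : zmodType) (S P : V -> Prop) :
  (forall x, S x -> P x) -> P 0 -> (forall x y, P x -> P y -> P (x - y)) ->
  forall x, x \in gen S -> P x.
Proof.
move=> SP P0 PB x /genP genx.
pose K : {pred V} := fun y => `[< P y >].
have K_closed : zmod_closed K.
  by split=> [|y z /asboolP Py /asboolP Pz]; apply/asboolP => //; apply: PB.
pose KZ : zmodClosed V := HB.pack K (GRing.isZmodClosed.Build V K K_closed).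
by have /asboolP := genx KZ (fun y Sy => asboolT (SP y Sy)).
Qed.

(** Two values at the same point differ by a value at 0, so the relation is single-valued, and a
    choice function for it is additive. The equivalence in the conclusion lets any witness of [R]
    compute [f]. *)
Lemma additive_of_relation (V W : zmodType) (R : V -> W -> Prop) :
  (forall x, exists y, R x y) ->
  (forall x y x' y', R x y -> R x' y' -> R (x - x') (y - y')) ->
  (forall y, R 0 y -> y = 0) ->
  exists f : {additive V -> W}, forall x y, R x y <-> y = f x.
Proof.
move=> /choice[f Rf] RB R0.
have Runiq x y y' : R x y -> R x y' -> y = y'.
  move=> Ry Ry'; apply/eqP; rewrite -subr_eq0; apply/eqP/R0.
  by rewrite -(subrr x); apply: RB.
have fB : zmod_morphism f by move=> x y; apply: Runiq (Rf _) (RB _ _ _ _ _ _).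
pose g : {additive V -> W} := HB.pack f (GRing.isZmodMorphism.Build V W f fB).
exists g => x y /=.
by split=> [Rxy|->//]; apply: Runiq Rxy (Rf x).
Qed.

(** * The bar complex *)

Section BarComplexSquare.
Variable G : finGroupType.

(* Indexing the entries by [nat] reduces the simplicial identities to arithmetic
   on indices. *)
Definition restrict_seq m (g : nat -> G) : {ffun 'I_m -> G} := [ffun k : 'I_m => g k].

Lemma restrict_seq_surj m (g : {ffun 'I_m -> G}) : exists h, g = restrict_seq m h.
Proof.
exists (fun n => if insub n is Some k then g k else 1%g).
by apply/ffunP => k; rewrite ffunE valK.
Qed.

Definition seq_face (i : nat) (g : nat -> G) (k : nat) : G :=
  if (k.+1 < i)%N then g k else if k.+1 == i then (g k * g k.+1)%g else g k.+1.

Lemma bar_face_restrict m (i : 'I_m.+2) g :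
  bar_face i (restrict_seq m.+1 g) = restrict_seq m (seq_face i g).
Proof. by apply/ffunP => k; rewrite !ffunE. Qed.

(** The simplicial identity for two successive faces. Associativity enters only when three
    consecutive entries are multiplied together, that is for [i = j + 1]. *)
Lemma seq_face_face (i j : nat) g : (j < i)%N ->
  seq_face j (seq_face i g) =1 seq_face i.-1 (seq_face j g).
Proof.
move=> ji k; rewrite /seq_face.
by do ![case: ltnP => ? | case: eqP => ?]; rewrite ?mulgA //; lia.
Qed.

Lemma bar_face_face m (i : 'I_m.+3) (j : 'I_m.+2) (i' : 'I_m.+2) (j' : 'I_m.+3)
    (g : {ffun 'I_m.+2 -> G}) :
  (j < i)%N -> i' = i.-1 :> nat -> j' = j :> nat ->
  bar_face j (bar_face i g) = bar_face i' (bar_face j' g).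
Proof.
move=> ji ei ej; have [h ->] := restrict_seq_surj g.
rewrite !bar_face_restrict; apply/ffunP => k.
by rewrite !ffunE ei ej seq_face_face.
Qed.

Variable A : gmod G.

(** Only face 0 twists the coefficient. The one delicate case is [j = 0], [i = 1], where both sides
    act by the inverse of the product of the first two entries. *)
Lemma bar_coef_coef m (i : 'I_m.+3) (j : 'I_m.+2) (i' : 'I_m.+2) (j' : 'I_m.+3)
    g (a : A) :
  (j < i)%N -> i' = i.-1 :> nat -> j' = j :> nat ->
  bar_coef j (bar_face i g) (bar_coef i g a) =
  bar_coef i' (bar_face j' g) (bar_coef j' g a).
Proof.
move=> ji ei ej; have [h ->] := restrict_seq_surj g.
rewrite !bar_face_restrict /bar_coef -!val_eqE /= ei ej !ffunE /= /seq_face /=.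
have -> : (i == 0 :> nat) = false by lia.
have [-> /=|j0] := eqVneq (j : nat) 0%N; last by have -> : (i.-1 == 0)%N = false by lia.
case: ifP => [i1|i1]; first by have -> : (i.-1 == 0)%N = false by lia.
case: eqP => [i1'|]; last by lia.
by rewrite -i1' /= invMg actM.
Qed.

Lemma bar_coef_sum m (i : 'I_m.+2) g (I : finType) (Q : pred I) (F : I -> A) :
  bar_coef i g (\sum_(k | Q k) F k) = \sum_(k | Q k) bar_coef i g (F k).
Proof. by rewrite /bar_coef; case: ifP => // _; rewrite raddf_sum. Qed.

Lemma bar_coefMz m (i : 'I_m.+2) g (a : A) n :
  bar_coef i g (a *~ n) = bar_coef i g a *~ n.
Proof. by rewrite /bar_coef; case: ifP => // _; rewrite raddfMz. Qed.

Lemma bar_bdK m (c : chain A m.+1) : bar_bd (bar_bd c) = 0.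
Proof.
case: m c => [|m] c //.
apply/ffunP => t; rewrite /= !ffunE.
(* [Phi i j] collects the terms where face [i] is followed by face [j]; in [e] they carry their
   sign. *)
pose Phi (i : 'I_m.+3) (j : 'I_m.+2) : A :=
  \sum_(g | bar_face j (bar_face i g) == t)
    bar_coef j (bar_face i g) (bar_coef i g (c g)).
pose e (p : 'I_m.+3 * 'I_m.+2) : A := Phi p.1 p.2 *~ (-1) ^+ (p.1 + p.2).
transitivity (\sum_p e p).
  rewrite -(pair_big xpredT xpredT (fun i j => e (i, j))) /= exchange_big /=.
  apply: eq_bigr => j _.
  under eq_bigr => s _ do rewrite ffunE bar_coef_sum mulrz_suml.
  rewrite exchange_big /=; apply: eq_bigr => i _.
  rewrite /e /Phi mulrz_suml -(sum_fiber (bar_face i) (fun s => bar_face j s == t)).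
  apply: eq_bigr => s _; rewrite bar_coef_sum mulrz_suml.
  apply: eq_bigr => g /eqP <-.
  by rewrite bar_coefMz -mulrzA exprD.
(* The simplicial identities pair off the terms with opposite signs. *)
pose h (p : 'I_m.+3 * 'I_m.+2) : 'I_m.+3 * 'I_m.+2 :=
  if (p.2 < p.1)%N then (inord p.2, inord p.1.-1) else (inord p.2.+1, inord p.1).
have hE p : (h p).1 = (if (p.2 < p.1)%N then p.2 : nat else p.2.+1) :> nat /\
            (h p).2 = (if (p.2 < p.1)%N then p.1.-1 else p.1) :> nat.
  case: p => [[i ilt] [j jlt]]; rewrite /h /=.
  by case: ltnP => ij /=; rewrite !inordK //; lia.
have hK : involutive h.
  move=> p; have [h1 h2] := hE p; have [h3 h4] := hE (h p).
  rewrite [LHS]surjective_pairing [RHS]surjective_pairing.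
  have [lt1 lt2] := (ltn_ord p.1, ltn_ord p.2).
  rewrite h1 h2 in h3 h4.
  by congr pair; apply: val_inj => /=; move: h3 h4;
    case: (ltnP p.2 p.1) => ?; case: ltnP => ? /=; lia.
rewrite (bigID (fun p : 'I_m.+3 * 'I_m.+2 => (p.2 < p.1)%N)) /=.
(* Reindexing by [h] moves the pairs with [i <= j] onto those with [j < i]. The index sum drops by
   one under [h], so matching terms cancel. *)
rewrite [X in _ + X](reindex_inj (inv_inj hK)) /=.
rewrite [X in _ + X](eq_bigl (fun p : 'I_m.+3 * 'I_m.+2 => (p.2 < p.1)%N)); last first.
  by move=> p; have [-> ->] := hE p; case: (ltnP p.2 p.1) => ? /=; lia.
rewrite -big_split big1 // => p pp; have [] := hE p; rewrite pp => h1 h2.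
rewrite /= /e; have -> : Phi p.1 p.2 = Phi (h p).1 (h p).2.
  apply: eq_big => [g|g _]; first by rewrite (bar_face_face _ pp h2 h1).
  exact: bar_coef_coef.
rewrite h1 h2 -mulrzDr.
have -> : (p.1 + p.2 = (p.2 + p.1.-1).+1)%N by lia.
by rewrite exprS mulN1r addNr.
Qed.

End BarComplexSquare.

(** * The long exact homology sequence *)

Section ChainSequence.
Variables (G : finGroupType).

Lemma simplex_map_id m (g : {ffun 'I_m -> G}) : simplex_map idfun g = g.
Proof. by apply/ffunP => k; rewrite ffunE. Qed.

(** Over the identity of [G] each fibre of [simplex_map] is a single point. Exactness of the
    sequence of chains can therefore be checked pointwise. *)
Lemma chain_map_glinE (A C : gmod G) (f : glin A C) m (c : chain A m) t :
  chain_map f c t = f (c t).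
Proof.
by rewrite ffunE (eq_bigl (pred1 t)) ?big_pred1_eq // => g; rewrite simplex_map_id.
Qed.

Lemma chain_mapB (A C : gmod G) (f : glin A C) m (c d : chain A m) :
  chain_map f (c - d) = chain_map f c - chain_map f d.
Proof. exact: raddfB. Qed.

Variable S : ses G.

Lemma chain_map_inj m (c d : chain (ses_sub S) m) :
  chain_map (ses_inj S) c = chain_map (ses_inj S) d -> c = d.
Proof.
move=> /ffunP cd; apply/ffunP => t; apply: (@ses_injective _ S).
by have := cd t; rewrite !chain_map_glinE.
Qed.

Lemma chain_map_surj m (d : chain (ses_quo S) m) :
  exists c, d = chain_map (ses_proj S) c.
Proof.
have [c dc] := choice (fun t => ses_surjective (d t)).
by exists [ffun t => c t]; apply/ffunP => t; rewrite chain_map_glinE ffunE.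
Qed.

Lemma chain_map_exact m :
  exact_at (@chain_map _ _ _ _ _ (ses_inj S) m) (@chain_map _ _ _ _ _ (ses_proj S) m).
Proof.
move=> c; split=> [/ffunP c0|[d ->]].
  have cker t : exists a, c t = ses_inj S a.
    by apply/(@ses_exact _ S); have := c0 t; rewrite chain_map_glinE ffunE.
  have [d cd] := choice cker.
  by exists [ffun t => d t]; apply/ffunP => t; rewrite chain_map_glinE ffunE.
apply/ffunP => t; rewrite !chain_map_glinE ffunE.
by apply/(@ses_exact _ S); exists (d t).
Qed.

End ChainSequence.

Section Homology.
Variables (G : finGroupType) (A : gmod G) (m : nat).

Lemma cycle_of_chain (c : chain A m) : bar_bd c = 0 -> exists z : cycle A m, val z = c.
Proof. by move=> /eqP cK; exists (exist _ c cK). Qed.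

Lemma bar_bdB (c d : chain A m.+1) : bar_bd (c - d) = bar_bd c - bar_bd d.
Proof. exact: (raddfB (@bar_bd G A m.+1)). Qed.

Lemma bar_bd0 : bar_bd (0 : chain A m.+1) = 0.
Proof. exact: (raddf0 (@bar_bd G A m.+1)). Qed.

(** Boundaries are already closed under subtraction, so passing to the generated subgroup adds
    nothing. *)
Lemma Hgrp_eq0 (z : cycle A m) : zpi (@boundary G A m) z = 0 <-> boundary z.
Proof.
split=> [/eqP|zb]; last by apply/eqP; rewrite zpi_eq0 mem_gen.
rewrite zpi_eq0; apply: (@gen_ind _ _ (@boundary G A m)) => [//||x y [c xc] [d yd]].
  by exists 0; rewrite bar_bd0.
by exists (c - d); rewrite bar_bdB -xc -yd.
Qed.

Lemma cycleP (z : cycle A m) : bar_bd (val z) = 0.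
Proof. by apply/eqP; apply: (valP z). Qed.

End Homology.

Lemma bar_bd_mapS (G H : finGroupType) (phi : {multiplicative G -> H})
    (A : gmod G) (C : gmod H) (f : gmor phi A C) m (c : chain A m.+1) :
  bar_bd (chain_map f c) = chain_map f (bar_bd c : chain A m).
Proof. exact: bar_bd_map. Qed.

Lemma HmapE (G H : finGroupType) (phi : {multiplicative G -> H}) (A : gmod G)
    (C : gmod H) (f : gmor phi A C) m z :
  Hmap f m (zpi _ z) = zpi _ (cycle_map f m z).
Proof. exact: zmapE. Qed.

(** * The connecting homomorphism and exactness in homology *)

Section ConnectingRelation.
Variables (G : finGroupType) (S : ses G).
Notation chi := (chain_map (ses_inj S)).
Notation chp := (chain_map (ses_proj S)).

(** The zigzag of the snake lemma: [c] lifts the cycle [z], and [w] is the boundary of [c] pulled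
    back along the injection. *)
Definition conn_rel m (x : Hgrp (ses_quo S) m.+1) (y : Hgrp (ses_sub S) m) : Prop :=
  exists (c : chain (ses_mid S) m.+1) (z : cycle (ses_quo S) m.+1)
         (w : cycle (ses_sub S) m),
    [/\ x = zpi _ z, y = zpi _ w, val z = chp c & chi (val w) = bar_bd c].

(** The boundary of [c] dies in the quotient, so it comes from a chain of the submodule. That chain
    is a cycle because the injection is injective on chains and the differential squares to zero. *)
Lemma conn_rel_lift m (c : chain (ses_mid S) m.+1) :
  bar_bd (chp c) = 0 -> exists w : cycle (ses_sub S) m, chi (val w) = bar_bd c.
Proof.
rewrite bar_bd_mapS => /(@chain_map_exact _ S)[w cw].
have /cycle_of_chain[z zw] : bar_bd w = 0.
  apply: (@chain_map_inj _ S).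
  by rewrite -bar_bd_map -cw [LHS]bar_bdK raddf0.
by exists z; rewrite zw.
Qed.

Lemma conn_rel_total m x : exists y, @conn_rel m x y.
Proof.
have [z xz] := zpi_surj x; have [c zc] := chain_map_surj (val z).
have [w wc] : exists w : cycle (ses_sub S) m, chi (val w) = bar_bd c.
  by apply: conn_rel_lift; rewrite -zc cycleP.
by exists (zpi _ w), c, z, w.
Qed.

Lemma conn_relB m x y x' y' :
  @conn_rel m x y -> conn_rel x' y' -> conn_rel (x - x') (y - y').
Proof.
move=> [c [z [w [-> -> zc wc]]]] [c' [z' [w' [-> -> zc' wc']]]].
exists (c - c'), (z - z'), (w - w').
split; [exact/esym/raddfB|exact/esym/raddfB|by rewrite chain_mapB -zc -zc'|].
by rewrite bar_bdB -wc -wc' -chain_mapB.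
Qed.

(** If [z] bounds, subtract from [c] the boundary of a lift [e] of the bounding chain. The
    difference comes from a chain [d] of the submodule, and [d] bounds [w]. *)
Lemma conn_rel0 m y : @conn_rel m 0 y -> y = 0.
Proof.
move=> [c [z [w [/esym/Hgrp_eq0[e'' ze] -> zc wc]]]].
have [e ee] := chain_map_surj e''.
have /(@chain_map_exact _ S)[d cd] : chp (c - bar_bd e) = 0.
  by rewrite chain_mapB -zc ze ee bar_bd_mapS subrr.
apply/Hgrp_eq0; exists d; apply: (@chain_map_inj _ S).
by rewrite wc -bar_bd_mapS -cd bar_bdB [X in _ - X]bar_bdK subr0.
Qed.

Definition conn_hom m : {additive Hgrp (ses_quo S) m.+1 -> Hgrp (ses_sub S) m} :=
  projT1 (cid (additive_of_relation (@conn_rel_total m) (@conn_relB m) (@conn_rel0 m))).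

Lemma conn_homP m x y : @conn_rel m x y <-> y = conn_hom m x.
Proof. exact: (projT2 (cid (additive_of_relation _ _ _))). Qed.

(** A chain [c] bounding the image of [w] projects to a cycle whose connecting image is the class of
    [w]. Degree 0 is included and later yields the statements on coinvariants. *)
Lemma Hmap_exact_sub m : exact_at (conn_hom m) (Hmap (ses_inj S) m).
Proof.
move=> y; split=> [|[x /conn_homP[c [z [w [_ -> _ wc]]]]]]; last first.
  by rewrite HmapE; apply/Hgrp_eq0; exists c.
have [w ->] := zpi_surj y; rewrite HmapE => /Hgrp_eq0[c wc].
have /cycle_of_chain[z zc] : bar_bd (chp c) = 0.
  by rewrite [LHS]bar_bd_mapS -wc; apply/(@chain_map_exact _ S); exists (val w).
by exists (zpi _ z); apply/conn_homP; exists c, z, w.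
Qed.

Lemma Hmap_exact_mid m : exact_at (Hmap (ses_inj S) m) (Hmap (ses_proj S) m).
Proof.
move=> y; split=> [|[x ->]]; last first.
  have [w ->] := zpi_surj x; rewrite !HmapE; apply/Hgrp_eq0; exists 0.
  by rewrite raddf0; apply/(@chain_map_exact _ S); exists (val w).
have [z ->] := zpi_surj y; rewrite HmapE => /Hgrp_eq0[c'' zc].
(* Correcting [z] by the boundary of a lift of [c''] makes it come from the submodule. *)
have [c cc] := chain_map_surj c''.
have /(@chain_map_exact _ S)[w zw] : chp (val z - bar_bd c) = 0.
  by rewrite chain_mapB -bar_bd_mapS -cc -zc subrr.
have /cycle_of_chain[t tw] : bar_bd w = 0.
  apply: (@chain_map_inj _ S).
  by rewrite -bar_bd_map -zw raddfB [X in X - _]cycleP [X in _ - X]bar_bdK subrr raddf0.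
exists (zpi _ t); rewrite HmapE; apply/eqP.
rewrite -subr_eq0 -raddfB; apply/eqP/Hgrp_eq0; exists c.
by rewrite raddfB /= tw -zw opprB addrC subrK.
Qed.

Lemma Hmap_exact_quo m : exact_at (Hmap (ses_proj S) m.+1) (conn_hom m).
Proof.
move=> x; split=> [/esym/conn_homP[c [z [w [-> /esym/Hgrp_eq0[d wd] zc wc]]]]|[y ->]].
  (* When [w] bounds [d], removing the image of [d] from [c] leaves a cycle that still projects to
     [z]. *)
  have /cycle_of_chain[t tc] : bar_bd (c - chi d) = 0.
    by rewrite [LHS]bar_bdB -wc bar_bd_mapS wd subrr.
  exists (zpi _ t); rewrite HmapE; congr zpi; apply: val_inj.
  rewrite zc /= tc chain_mapB (_ : chp (chi d) = 0) ?subr0 //.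
  by apply/(@chain_map_exact _ S); exists d.
have [z ->] := zpi_surj y; apply/esym/conn_homP.
exists (val z), (cycle_map (ses_proj S) m.+1 z), 0.
by split; rewrite ?HmapE ?raddf0 ?cycleP.
Qed.

End ConnectingRelation.

(** * Naturality of the homology sequence *)

Section ConnectingNatural.
Variables (G H : finGroupType) (phi : {multiplicative G -> H}).
Variables (S : ses G) (T : ses H) (F : ses_mor phi S T).

Lemma chain_map_square (A B : gmod G) (C D : gmod H) (f : glin A B) (h : glin C D)
    (u : gmor phi A C) (v : gmor phi B D) m (c : chain A m) :
  (forall a, v (f a) = h (u a)) ->
  chain_map v (chain_map f c) = chain_map h (chain_map u c).
Proof.
move=> vf; apply/ffunP => t; rewrite chain_map_glinE !ffunE raddf_sum.
by apply: eq_bigr => g _; rewrite chain_map_glinE vf.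
Qed.

Lemma Hmap_square (A B : gmod G) (C D : gmod H) (f : glin A B) (h : glin C D)
    (u : gmor phi A C) (v : gmor phi B D) m x :
  (forall a, v (f a) = h (u a)) ->
  Hmap v m (Hmap f m x) = Hmap h m (Hmap u m x).
Proof.
move=> vf; have [z ->] := zpi_surj x; rewrite !HmapE; congr zpi.
by apply: val_inj; apply: chain_map_square.
Qed.

Lemma conn_hom_natural m x :
  Hmap (mor_sub F) m (conn_hom S m x) = conn_hom T m (Hmap (mor_quo F) m.+1 x).
Proof.
have /conn_homP[c [z [w [xz -> zc wc]]]] := erefl (conn_hom S m x).
apply/conn_homP; exists (chain_map (mor_mid F) c), (cycle_map (mor_quo F) m.+1 z),
  (cycle_map (mor_sub F) m w).
split; rewrite ?xz ?HmapE //=; first by rewrite zc; apply/chain_map_square/mor_proj.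
by rewrite -(chain_map_square _ (mor_inj F)) wc -bar_bd_mapS.
Qed.

End ConnectingNatural.

(** * Degree zero: coinvariants and their torsion *)

Section DegreeZero.
Variables (G : finGroupType).

Lemma ffun_ord0_eq (s t : {ffun 'I_0 -> G}) : s = t.
Proof. by apply/ffunP => -[]. Qed.

Let t0 : {ffun 'I_0 -> G} := [ffun=> 1%g].

Lemma bar_bd1E (A : gmod G) (c : chain A 1) t :
  (bar_bd c : chain A 0) t =
  \sum_(g : {ffun 'I_1 -> G}) (act A (g ord0)^-1%g (c g) - c g).
Proof.
rewrite ffunE !big_ord_recl big_ord0 addr0 /=.
(* Both faces of a 1-simplex are the unique empty tuple, so the fibre condition is always true. *)
under eq_bigl => g do rewrite (ffun_ord0_eq (bar_face _ g) t) eqxx.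
under [X in _ + X]eq_bigl => g do rewrite (ffun_ord0_eq (bar_face _ g) t) eqxx.
rewrite -big_split /=; apply: eq_bigr => g _.
by rewrite expr0 mulr1z expr1 mulrN1z.
Qed.

Lemma bar_bd1_mem (A : gmod G) (c : chain A 1) t :
  (bar_bd c : chain A 0) t \in gen (@coinv_rel G A).
Proof.
rewrite bar_bd1E rpred_sum // => g _; apply: mem_gen.
by exists (g ord0)^-1%g, (c g).
Qed.

Lemma coinv_rel_bar_bd1 (A : gmod G) a :
  a \in gen (@coinv_rel G A) -> exists c : chain A 1, (bar_bd c : chain A 0) t0 = a.
Proof.
move: a; apply: gen_ind => [x [g [a ->]]||x y [c <-] [d <-]].
(* The chain is [a] placed at the inverse of [g], since face 0 acts by the inverse of the first
   entry. *)
- exists [ffun h : {ffun 'I_1 -> G} => if h == [ffun=> g^-1%g] then a else 0].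
  rewrite bar_bd1E (bigD1 [ffun=> g^-1%g]) //= !ffunE eqxx invgK big1 ?addr0 // => h.
  by move=> /negPf hg; rewrite ffunE hg raddf0 subrr.
- by exists 0; rewrite bar_bd0 ffunE.
- by exists (c - d); rewrite bar_bdB !ffunE.
Qed.

Section Iso.
Variable A : gmod G.

Definition cycle0_coinv (z : cycle A 0) : coinv A := zpi _ (val z t0).

Lemma cycle0_coinv_is_zmod_morphism : zmod_morphism cycle0_coinv.
Proof. by move=> x y; rewrite /cycle0_coinv -raddfB !ffunE. Qed.

HB.instance Definition _ := GRing.isZmodMorphism.Build (cycle A 0) (coinv A)
  cycle0_coinv cycle0_coinv_is_zmod_morphism.

Lemma cycle0_coinv_boundary z : boundary z -> cycle0_coinv z = 0.
Proof.
by case=> c zc; apply/eqP; rewrite zpi_eq0 zc bar_bd1_mem.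
Qed.

(** The standard isomorphism from degree-zero homology to coinvariants, evaluating a 0-chain at the
    empty tuple. *)
Definition H0_coinv : {additive Hgrp A 0 -> coinv A} := zlift cycle0_coinv_boundary.

Lemma H0_coinvE z : H0_coinv (zpi _ z) = zpi _ (val z t0).
Proof. exact: zliftE. Qed.

Lemma H0_coinv_inj : injective H0_coinv.
Proof.
apply: raddf_inj => x; have [z ->] := zpi_surj x.
rewrite H0_coinvE => /eqP; rewrite zpi_eq0 => /coinv_rel_bar_bd1[c cz].
apply/Hgrp_eq0; exists c; apply/ffunP => t.
by rewrite (ffun_ord0_eq t t0) cz.
Qed.

Lemma H0_coinv_surj y : exists x, y = H0_coinv x.
Proof.
have [a ->] := zpi_surj y.
(* The differential out of degree 0 is zero, so every 0-chain is a cycle. *)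
have [|z za] := @cycle_of_chain G A 0 [ffun=> a]; first by [].
by exists (zpi _ z); rewrite H0_coinvE za ffunE.
Qed.

End Iso.

End DegreeZero.

Lemma coinv_mapE (G H : finGroupType) (phi : {multiplicative G -> H})
    (A : gmod G) (C : gmod H) (f : gmor phi A C) a :
  coinv_map f (zpi _ a) = zpi _ (f a).
Proof. exact: zmapE. Qed.

Lemma H0_coinv_natural (G H : finGroupType) (phi : {multiplicative G -> H})
    (A : gmod G) (C : gmod H) (f : gmor phi A C) x :
  H0_coinv C (Hmap f 0 x) = coinv_map f (H0_coinv A x).
Proof.
have [z ->] := zpi_surj x; rewrite HmapE !H0_coinvE coinv_mapE; congr zpi.
rewrite ffunE (big_pred1 [ffun=> 1%g]) // => g.
by rewrite /=; apply/eqP/eqP => _; apply: ffun_ord0_eq.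
Qed.

(** * The norm map and the torsion kernel on coinvariants *)

Section Norm.
Variables (G : finGroupType) (A : gmod G).

Definition norm_act (a : A) : A := \sum_g act A g a.

(** Right translation by [g] permutes the group, so [act A g a] and [a] have the same norm. *)
Lemma norm_act_coinv a : a \in gen (@coinv_rel G A) -> norm_act a = 0.
Proof.
move: a; apply: gen_ind => [x [g [a ->]]||x y x0 y0].
- rewrite /norm_act; under eq_bigr => h _ do rewrite raddfB -actM.
  rewrite sumrB; apply/eqP; rewrite subr_eq0; apply/eqP.
  by rewrite [RHS](reindex_inj (mulIg g)).
- by rewrite /norm_act big1 // => g _; rewrite raddf0.
rewrite /norm_act; under eq_bigr => g _ do rewrite raddfB.
by rewrite sumrB -!/(norm_act _) x0 y0 subrr.
Qed.

Lemma zpi_norm_act a : zpi (@coinv_rel G A) (norm_act a) = zpi _ a *+ #|G|.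
Proof.
rewrite raddf_sum -sumr_const; apply: eq_bigr => g _.
apply/eqP; rewrite -subr_eq0 -raddfB zpi_eq0; apply: mem_gen.
by exists g, a.
Qed.

End Norm.

(* If the class of [f a] vanishes, so does the norm of [f a], hence that of [a]; but
   the norm acts on coinvariants as multiplication by [#|G|]. *)
Lemma coinv_map_ker_torsion (G : finGroupType) (A C : gmod G) (f : glin A C) x :
  injective f -> coinv_map f x = 0 -> x \in torsion _.
Proof.
have [a ->] := zpi_surj x; rewrite coinv_mapE => f_inj /eqP.
rewrite zpi_eq0 => /norm_act_coinv fa.
apply/asboolP; exists #|G|; split; first by apply/card_gt0P; exists 1%g.
rewrite -zpi_norm_act (_ : norm_act a = 0) ?raddf0 //.
apply: f_inj; rewrite raddf0 -fa raddf_sum.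
by apply: eq_bigr => g _; rewrite gmorJ.
Qed.

(** * Exactness on coinvariants and on their torsion subgroups *)

Section CoinvariantsSequence.
Variables (G : finGroupType) (S : ses G).

Lemma coinv_exact : exact_at (coinv_map (ses_inj S)) (coinv_map (ses_proj S)).
Proof.
move=> y; have [x ->] := H0_coinv_surj y; rewrite -H0_coinv_natural; split.
  rewrite -(raddf0 (H0_coinv _)) => /H0_coinv_inj/Hmap_exact_mid[u ->].
  by exists (H0_coinv _ u); rewrite H0_coinv_natural.
move=> [v xv]; have [u vu] := H0_coinv_surj v.
have -> : x = Hmap (ses_inj S) 0 u.
  by apply: H0_coinv_inj; rewrite H0_coinv_natural -vu.
rewrite (_ : Hmap _ 0 _ = 0) ?raddf0 //.
by apply/(@Hmap_exact_mid _ S); exists u.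
Qed.

Lemma coinv_map_surj y : exists x, y = coinv_map (ses_proj S) x.
Proof.
have [b ->] := zpi_surj y; have [a ->] := ses_surjective b.
by exists (zpi _ a); rewrite coinv_mapE.
Qed.

(** The connecting map lands in the kernel of the map induced by the injection, which is torsion.
    Hence it can be corestricted to give [conn_ctors]. *)
Lemma conn_coinv_torsion x :
  H0_coinv _ (conn_hom S 0 x) \in torsion (coinv (ses_sub S)).
Proof.
apply: coinv_map_ker_torsion (@ses_injective _ S) _.
rewrite -H0_coinv_natural (_ : Hmap _ 0 _ = 0) ?raddf0 //.
by apply/(@Hmap_exact_sub _ S); exists x.
Qed.

Definition conn_ctors_fun (x : Hgrp (ses_quo S) 1) : ctors (ses_sub S) :=
  exist (fun y => y \in torsion _) _ (conn_coinv_torsion x).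

Lemma conn_ctors_is_zmod_morphism : zmod_morphism conn_ctors_fun.
Proof. by move=> x y; apply: val_inj; rewrite /= !raddfB. Qed.

HB.instance Definition _ := GRing.isZmodMorphism.Build (Hgrp (ses_quo S) 1)
  (ctors (ses_sub S)) conn_ctors_fun conn_ctors_is_zmod_morphism.

Definition conn_ctors : {additive Hgrp (ses_quo S) 1 -> ctors (ses_sub S)} :=
  conn_ctors_fun.

Lemma conn_ctors_exact_quo : exact_at (Hmap (ses_proj S) 1) conn_ctors.
Proof.
move=> x; split=> [/(congr1 val)/=|/(@Hmap_exact_quo _ S) x0].
  by rewrite -(raddf0 (H0_coinv _)) => /H0_coinv_inj/Hmap_exact_quo.
by apply: val_inj; rewrite /= x0 raddf0.
Qed.

Lemma conn_ctors_exact_sub : exact_at conn_ctors (ctors_map (ses_inj S)).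
Proof.
move=> y; split=> [/(congr1 val)/=|[x ->]]; last first.
  apply: val_inj; rewrite /= -H0_coinv_natural (_ : Hmap _ 0 _ = 0) ?raddf0 //.
  by apply/(@Hmap_exact_sub _ S); exists x.
have [u yu] := H0_coinv_surj (val y); rewrite yu -H0_coinv_natural.
rewrite -(raddf0 (H0_coinv _)) => /H0_coinv_inj/Hmap_exact_sub[x ux].
by exists x; apply: val_inj; rewrite /= -ux.
Qed.

Lemma ctors_exact_mid : exact_at (ctors_map (ses_inj S)) (ctors_map (ses_proj S)).
Proof.
move=> y; split=> [/(congr1 val)/=|[x ->]]; last first.
  by apply: val_inj => /=; apply/(@coinv_exact); exists (val x).
move=> /coinv_exact[x yx].
have /asboolP[n [n0 yn]] := valP y.
(* The preimage [x] must itself be shown torsion: [n] kills [y], so [x *+ n] lies in the torsion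
   kernel. *)
have : x *+ n \in torsion _.
  apply: coinv_map_ker_torsion (@ses_injective _ S) _.
  by rewrite raddfMn -yx.
move=> /asboolP[m [m0 xnm]].
have xT : x \in torsion _.
  by apply/asboolP; exists (n * m)%N; rewrite muln_gt0 n0 m0 mulrnA.
by exists (exist (fun y => y \in torsion _) x xT); apply: val_inj.
Qed.

End CoinvariantsSequence.

Lemma conn_ctors_natural (G H : finGroupType) (phi : {multiplicative G -> H})
    (S : ses G) (T : ses H) (F : ses_mor phi S T) x :
  ctors_map (mor_sub F) (conn_ctors S x) = conn_ctors T (Hmap (mor_quo F) 1 x).
Proof. by apply: val_inj; rewrite /= -H0_coinv_natural conn_hom_natural. Qed.

(** * Coinvariants of the tensor product with Q/Z *)

Section Tensor.
Variables (U V : zmodType).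

Lemma tpureDl (u u' : U) (v : V) : tpure (u + u') v = tpure u v + tpure u' v.
Proof.
apply/eqP; rewrite -subr_eq0 opprD addrA /tpure -!raddfB zpi_eq0.
by apply: mem_gen; apply: BilinearL.
Qed.

Lemma tpureDr (u : U) (v v' : V) : tpure u (v + v') = tpure u v + tpure u v'.
Proof.
apply/eqP; rewrite -subr_eq0 opprD addrA /tpure -!raddfB zpi_eq0.
by apply: mem_gen; apply: BilinearR.
Qed.

Lemma tens_ind (P : tens U V -> Prop) :
  (forall u v, P (tpure u v)) -> P 0 -> (forall x y, P x -> P y -> P (x - y)) ->
  forall x, P x.
Proof.
move=> Pp P0 PB x.
have PN y : P y -> P (- y) by move=> Py; rewrite -sub0r; apply: PB.
have PD y z : P y -> P z -> P (y + z).
  by move=> Py Pz; rewrite -[z]opprK; apply: PB => //; apply: PN.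
have PM y n : P y -> P (y *+ n).
  by move=> Py; elim: n => [|n IHn]; rewrite ?mulr0n // mulrS; apply: PD.
have [D ->] := zpi_surj x; rewrite -(freeg_sumE D) raddf_sum.
elim/big_ind: _ => // -[u v] _; rewrite -[coeff _ D]intz -freegU_mulz raddfMz.
by case: (coeff _ D) => n; [apply: PM | apply/PN/PM]; apply: Pp.
Qed.

End Tensor.

Section CoinvariantTensor.
Variables (G : finGroupType) (A : gmod G).

Section FixedScalar.
Variable q : QmodZ.

Definition tensQZ_class (a : A) : coinv (tensQZ A) :=
  zpi (@coinv_rel G (tensQZ A)) (tpure a q).

Lemma tensQZ_class_is_nmod_morphism : nmod_morphism tensQZ_class.
Proof.
have D a b : tensQZ_class (a + b) = tensQZ_class a + tensQZ_class b.
  by rewrite /tensQZ_class tpureDl raddfD.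
split=> //; apply: (addrI (tensQZ_class 0)).
by rewrite -D !addr0.
Qed.

HB.instance Definition _ := GRing.isNmodMorphism.Build A (coinv (tensQZ A))
  tensQZ_class tensQZ_class_is_nmod_morphism.

Lemma tensQZ_class_coinv a : coinv_rel a -> tensQZ_class a = 0.
Proof.
case=> g [b ->]; rewrite raddfB /= /tensQZ_class -raddfB; apply/eqP; rewrite zpi_eq0.
apply: mem_gen; exists g, (tpure b q).
by rewrite /= (tens_mapE (act A g)).
Qed.

(** Tensoring with a fixed [q], descended to coinvariants; computations in the coinvariants of the
    tensor product thereby reduce to those of [A]. *)
Definition ctens : {additive coinv A -> coinv (tensQZ A)} := zlift tensQZ_class_coinv.

Lemma ctensE a : ctens (zpi _ a) = zpi (@coinv_rel G (tensQZ A)) (tpure a q).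
Proof. exact: zliftE. Qed.

End FixedScalar.

Lemma ctensDr q q' x : ctens (q + q') x = ctens q x + ctens q' x.
Proof. by have [a ->] := zpi_surj x; rewrite !ctensE tpureDr raddfD. Qed.

Lemma ctens0r x : ctens 0 x = 0.
Proof. by apply: (addrI (ctens 0 x)); rewrite -ctensDr !addr0. Qed.

Lemma ctensMnr q n x : ctens (q *+ n) x = ctens q (x *+ n).
Proof.
elim: n => [|n IHn]; first by rewrite !mulr0n ctens0r raddf0.
by rewrite !mulrS ctensDr raddfD IHn.
Qed.

Lemma ctensNr q x : ctens (- q) x = - ctens q x.
Proof. by apply: (addrI (ctens q x)); rewrite -ctensDr !subrr ctens0r. Qed.

End CoinvariantTensor.

Lemma ctens_natural (G H : finGroupType) (phi : {multiplicative G -> H})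
    (A : gmod G) (C : gmod H) (f : gmor phi A C) q x :
  coinv_map (tensQZ_map f) (ctens A q x) = ctens C q (coinv_map f x).
Proof.
have [a ->] := zpi_surj x; rewrite ctensE !coinv_mapE ctensE.
by congr zpi; apply: (tens_mapE f).
Qed.

Section UnitFractions.

Definition qfrac (n : nat) : QmodZ := zpi _ (n%:R^-1 : rat).

(** The case [n = 0] is covered because the inverse of 0 is 0. *)
Lemma qfracM m n : (0 < m)%N -> qfrac (n * m) *+ m = qfrac n.
Proof.
move=> m0; rewrite /qfrac -raddfMn; congr zpi.
have m0' : (m%:R : rat) != 0 by rewrite pnatr_eq0 -lt0n.
by rewrite -[LHS]mulr_natr natrM invfM mulfVK.
Qed.

Lemma qfrac_self n : (0 < n)%N -> qfrac n *+ n = 0.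
Proof.
move=> n0; rewrite -[n in qfrac n]mul1n qfracM //.
by apply/eqP; rewrite zpi_eq0; apply: mem_gen; exists 1; rewrite invr1.
Qed.

Lemma qfrac_surj q : exists n k, (0 < n)%N /\ q = qfrac n *~ k.
Proof.
have [r ->] := zpi_surj q; exists `|denq r|%N, (numq r); split.
  by rewrite absz_gt0 denq_neq0.
rewrite /qfrac -raddfMz; congr zpi.
by rewrite -[RHS]mulrzl -[LHS]divq_num_den -absz_denq -pmulrn.
Qed.

Lemma QmodZ_divisible m q : (0 < m)%N -> exists q' : QmodZ, q = q' *+ m.
Proof.
move=> m0; have [n [k [_ ->]]] := qfrac_surj q; exists (qfrac (n * m) *~ k).
by rewrite [RHS]pmulrn -mulrzA mulrC mulrzA -pmulrn qfracM.
Qed.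

Variables (G : finGroupType) (A : gmod G).

Lemma ctens_qfracM m n x : (0 < m)%N ->
  ctens A (qfrac (n * m)) (x *+ m) = ctens A (qfrac n) x.
Proof. by move=> m0; rewrite -ctensMnr qfracM. Qed.

Lemma ctens_qfrac_kill n x : (0 < n)%N -> ctens A (qfrac n) (x *+ n) = 0.
Proof. by move=> n0; rewrite -ctensMnr qfrac_self // ctens0r. Qed.

(** By divisibility of Q/Z, [q] is [n] times some [q'], and the factor [n] moves across to kill
    [x]. *)
Lemma ctens_torsion q x : x \in torsion _ -> ctens A q x = 0.
Proof.
move=> /asboolP[n [n0 xn]]; have [q' ->] := QmodZ_divisible q n0.
by rewrite ctensMnr xn raddf0.
Qed.

Lemma ctens_surj y : exists n x, (0 < n)%N /\ y = ctens A (qfrac n) x.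
Proof.
have [t ->] := zpi_surj y; move: t; apply: tens_ind => [a q||s t].
- have [n [k [n0 ->]]] := qfrac_surj q.
  exists n, (zpi _ a *~ k); split=> //.
  case: k => k; first by rewrite -pmulrn -ctensMnr ctensE.
  by rewrite !NegzE !mulrNz -!pmulrn raddfN -ctensMnr -ctensNr ctensE.
- by exists 1%N, 0; rewrite !raddf0.
move=> [n [x [n0 sx]]] [m [z [m0 tz]]].
(* Both fractions are rewritten over the common denominator [n * m]. *)
exists (n * m)%N, (x *+ m - z *+ n); split; first by rewrite muln_gt0 n0.
rewrite [RHS]raddfB ctens_qfracM // mulnC ctens_qfracM // -sx -tz.
exact: raddfB.
Qed.

End UnitFractions.

(** * When a tensor with a unit fraction vanishes *)

Section TensorVanishing.
Variable V : zmodType.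

Definition QmodZ_repr (q : QmodZ) : rat := projT1 (cid (zpi_surj q)).

Lemma QmodZ_reprK q : zpi _ (QmodZ_repr q) = q.
Proof. exact/esym/(projT2 (cid (zpi_surj q))). Qed.

Lemma QmodZ_eq (r s : rat) :
  zpi (fun x : rat => exists n : int, x = n%:~R) r = zpi _ s ->
  exists n : int, r = s + n%:~R.
Proof.
move=> /eqP; rewrite -subr_eq0 -raddfB zpi_eq0 => rs.
suff [n rsn] : exists n : int, r - s = n%:~R by exists n; rewrite -rsn addrC subrK.
move: rs; move: (r - s); apply: gen_ind => [//||x y [m ->] [n ->]].
  by exists 0.
by exists (m - n); rewrite rmorphB.
Qed.

(* When [M] clears the denominators, this is multiplication by the integer [M q]
   modulo [M], and so factors through the tensor product as a map into [V / M V]. *)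
Definition scaled_eval (M : nat) : {additive {freeg (V * QmodZ) / int} -> zmodule V} :=
  fglift (fun p => (p.1 *~ Num.floor (M%:R * QmodZ_repr p.2) : zmodule V)).

Lemma scaled_evalU M v q :
  scaled_eval M << (v, q) >> = v *~ Num.floor (M%:R * QmodZ_repr q).
Proof. by rewrite /scaled_eval /= liftU scale1r. Qed.

Lemma floor_mul_denq (M : nat) (r : rat) : (`|denq r| %| M)%N ->
  (Num.floor (M%:R * r))%:~R = M%:R * r.
Proof.
move=> /dvdnP[k ->]; rewrite natrM -mulrA [_%:R * r]mulrC.
have -> : r * `|denq r|%N%:R = (numq r)%:~R.
  by rewrite pmulrn absz_denq -[X in X * _]divq_num_den divfK // intr_eq0 denq_eq0.
by rewrite -[k%:R]/(k%:~R) -intrM intrKfloor.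
Qed.

(** No single [M] clears all denominators, so the claim concerns all multiples of some [N] depending
    on [D]; bounds multiply when elements are combined. In the right-linearity relation, the
    representatives fail to add up by an integer [j], which contributes [M * j] times [u]. *)
Lemma scaled_eval_rel D : D \in gen (@bilinear_rel V QmodZ) ->
  exists N, (0 < N)%N /\
    forall M, (N %| M)%N -> exists c : V, scaled_eval M D = c *+ M.
Proof.
move: D; apply: gen_ind => [D||D E [N [N0 DN]] [P [P0 EP]]]; last 2 first.
- by exists 1%N; split=> // M _; exists 0; rewrite raddf0 mul0rn.
- exists (N * P)%N; rewrite muln_gt0 N0; split=> // M NPM.
  have [c Dc] := DN M (dvdn_trans (dvdn_mulr _ (dvdnn _)) NPM).
  have [d Ed] := EP M (dvdn_trans (dvdn_mull _ (dvdnn _)) NPM).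
  by exists (c - d); rewrite raddfB Dc Ed mulrnBl.
case=> [u1 u2 q|u q1 q2].
  exists 1%N; split=> // M _; exists 0.
  by rewrite !raddfB /= !scaled_evalU mulrzDl -addrA -opprD subrr mul0rn.
set r1 := QmodZ_repr q1; set r2 := QmodZ_repr q2; set r := QmodZ_repr (q1 + q2).
have [j rj] : exists j : int, r = r1 + r2 + j%:~R.
  apply: QmodZ_eq; rewrite QmodZ_reprK -[in LHS](QmodZ_reprK q1).
  by rewrite -[in LHS](QmodZ_reprK q2); apply/esym/raddfD.
(* This product of denominators makes all three floors exact. *)
exists (`|denq r| * `|denq r1| * `|denq r2|)%N.
rewrite !muln_gt0 !absz_gt0 !denq_eq0; split=> // M dM; exists (u *~ j).
rewrite !raddfB /= !scaled_evalU -/r -/r1 -/r2 -!mulrzBr [RHS]pmulrn -[RHS]mulrzA.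
congr (_ *~ _); apply: (@intr_inj rat).
rewrite !rmorphB rmorphM /= !floor_mul_denq; last 3 first.
- by apply: dvdn_trans dM; rewrite dvdn_mull.
- by apply: dvdn_trans dM; rewrite mulnAC dvdn_mull.
- by apply: dvdn_trans dM; rewrite -mulnA dvdn_mulr.
by rewrite rj; ring.
Qed.

Lemma tpure_qfrac_eq0 (v : V) n : (0 < n)%N -> tpure v (qfrac n) = 0 ->
  exists c, v - c *+ n \in torsion V.
Proof.
(* Evaluating at [M = N * n] clears the denominator [n]; dividing the outcome by [n] leaves a
   relation killed only by [N], hence the torsion. *)
move=> n0 /eqP; rewrite zpi_eq0 => /scaled_eval_rel[N [N0 /(_ (N * n)%N)]].
set r := QmodZ_repr (qfrac n).
have [j rj] : exists j : int, r = n%:R^-1 + j%:~R by apply/QmodZ_eq/QmodZ_reprK.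
have n0' : (n%:R : rat) != 0 by rewrite pnatr_eq0 -lt0n.
rewrite scaled_evalU -/r (_ : Num.floor _ = N%:Z + N%:Z * n%:Z * j); last first.
  rewrite -[RHS](@intrKfloor rat) rmorphD !rmorphM /=; congr Num.floor.
  by rewrite rj -!pmulrn; field.
move=> /(_ (dvdn_mulr _ (dvdnn _)))[c vc]; exists (c - v *~ j).
apply/asboolP; exists N; split=> //.
have {}vc : v *+ N + v *~ j *+ (N * n) = c *+ (N * n).
  by rewrite -vc mulrzDr [in RHS]mulrC mulrzA -PoszM -!pmulrn.
by rewrite !mulrnBl -!mulrnA [(n * N)%N]mulnC -vc addrK subrr.
Qed.

End TensorVanishing.

(** The projection to coinvariants, tensored with Q/Z, kills the relations of the diagonal action.
    It thus carries the vanishing into the tensor product of [coinv A] with Q/Z, where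
    [tpure_qfrac_eq0] applies. *)
Lemma ctens_qfrac_eq0 (G : finGroupType) (A : gmod G) n (x : coinv A) :
  (0 < n)%N -> ctens A (qfrac n) x = 0 -> exists c, x - c *+ n \in torsion _.
Proof.
move=> n0; pose p : {additive A -> coinv A} := zpi (@coinv_rel G A).
have pJ y : coinv_rel (A := tensQZ A) y -> tens_map QmodZ p y = 0.
  case=> g [t ->]; rewrite raddfB; apply/eqP; rewrite subr_eq0; apply/eqP.
  pose l := tens_map QmodZ p \o tens_map QmodZ (act A g).
  apply: (@tens_additive_eq _ _ _ l) => a q.
  rewrite /l /= (tens_mapE (act A g)) !(tens_mapE p); congr (tpure _ _).
  apply/eqP; rewrite -subr_eq0 -raddfB /p zpi_eq0; apply: mem_gen.
  by exists g, a.
have [a ->] := zpi_surj x => xn0; apply: (tpure_qfrac_eq0 n0).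
rewrite -(tens_mapE p) -(zliftE pJ) -(raddf0 (zlift pJ)); congr (zlift pJ _).
by rewrite -xn0 ctensE.
Qed.

(** * The end of the sequence *)

Section TensorSequence.
Variables (G : finGroupType) (S : ses G).
Notation i := (coinv_map (ses_inj S)).
Notation p := (coinv_map (ses_proj S)).
Notation ti := (coinv_map (tensQZ_map (ses_inj S))).
Notation tp := (coinv_map (tensQZ_map (ses_proj S))).

Let pi0 x : p (i x) = 0.
Proof. by apply/coinv_exact; exists x. Qed.

Let ker_i x : i x = 0 -> x \in torsion _.
Proof. exact/coinv_map_ker_torsion/ses_injective. Qed.

(* Snake for multiplication by [n]: if [n x = 0], lift [x] to [a] and write
   [n a = i a']; the image of [x] is the class of [a' (x) 1/n]. *)
Definition conn_tens_rel (x : ctors (ses_quo S)) (y : coinv (tensQZ (ses_sub S))) :=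
  exists n a a',
    [/\ (0 < n)%N, val x = p a, i a' = a *+ n & y = ctens _ (qfrac n) a'].

Lemma conn_tens_rel_total x : exists y, conn_tens_rel x y.
Proof.
have /asboolP[n [n0 xn]] := valP x; have [a xa] := coinv_map_surj (val x).
have /coinv_exact[a' aa'] : p (a *+ n) = 0 by rewrite raddfMn -xa.
by exists (ctens _ (qfrac n) a'), n, a, a'.
Qed.

Lemma conn_tens_relB x y x' y' :
  conn_tens_rel x y -> conn_tens_rel x' y' -> conn_tens_rel (x - x') (y - y').
Proof.
move=> [n [a [a' [n0 xa aa' ->]]]] [m [b [b' [m0 xb bb' ->]]]].
exists (n * m)%N, (a - b), (a' *+ m - b' *+ n); split.
- by rewrite muln_gt0 n0.
- by rewrite [RHS]raddfB -xa -xb.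
- by rewrite raddfB 2!raddfMn aa' bb' -!mulrnA [(m * n)%N]mulnC mulrnBl.
- by rewrite [RHS]raddfB ctens_qfracM // mulnC ctens_qfracM.
Qed.

(** A lift of 0 is [i c], so [a' - c *+ n] lies in the torsion kernel of [i]. Torsion dies in the
    tensor product, and so does [c *+ n] against 1/n. *)
Lemma conn_tens_rel0 y : conn_tens_rel 0 y -> y = 0.
Proof.
move=> [n [a [a' [n0 /esym/coinv_exact[c ac] aa' ->]]]].
have : a' - c *+ n \in torsion _.
  by apply: ker_i; rewrite raddfB raddfMn aa' ac subrr.
move=> /(ctens_torsion (qfrac n)); rewrite raddfB ctens_qfrac_kill // subr0.
exact.
Qed.

Definition conn_tens : {additive ctors (ses_quo S) -> coinv (tensQZ (ses_sub S))} :=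
  projT1 (cid (additive_of_relation conn_tens_rel_total conn_tens_relB conn_tens_rel0)).

Lemma conn_tensP x y : conn_tens_rel x y <-> y = conn_tens x.
Proof. exact: (projT2 (cid (additive_of_relation _ _ _))). Qed.

Lemma conn_tens_exact_quo : exact_at (ctors_map (ses_proj S)) conn_tens.
Proof.
move=> x; split=> [/esym/conn_tensP[n [a [a' [n0 xa aa']]]]|[a ->]].
  move=> /esym/(ctens_qfrac_eq0 n0)[c /asboolP[k [k0 ack]]].
  (* Subtracting [i c] keeps the image in the quotient and makes the lift torsion. *)
  have aT : a - i c \in torsion _.
    apply/asboolP; exists (n * k)%N; rewrite muln_gt0 n0 k0; split=> //.
    by rewrite mulrnA mulrnBl -aa' -raddfMn -raddfB -raddfMn ack raddf0.
  exists (exist (fun y => y \in torsion _) _ aT); apply: val_inj.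
  by rewrite /= raddfB pi0 subr0.
have /asboolP[n [n0 an]] := valP a.
apply/esym/conn_tensP; exists n, (val a), 0.
by rewrite !raddf0 an.
Qed.

Lemma conn_tens_exact_sub : exact_at conn_tens ti.
Proof.
move=> y; split=> [|[x /conn_tensP[n [a [a' [n0 _ aa' ->]]]]]]; last first.
  by rewrite ctens_natural aa' ctens_qfrac_kill.
have [n [a' [n0 ->]]] := ctens_surj y; rewrite ctens_natural.
move=> /(ctens_qfrac_eq0 n0)[c /asboolP[k [k0 ack]]].
have kn0 : (0 < n * k)%N by rewrite muln_gt0 n0.
have ack' : i (a' *+ k) = c *+ (n * k).
  by apply/eqP; rewrite raddfMn -subr_eq0 mulrnA -mulrnBl ack.
(* The preimage is the class of [p c]: it is killed by [n * k], with lift [c] and pullback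
   [a' *+ k]. *)
have cT : p c \in torsion _.
  by apply/asboolP; exists (n * k)%N; rewrite -raddfMn -ack' pi0.
exists (exist (fun y => y \in torsion _) _ cT); apply/conn_tensP.
by exists (n * k)%N, c, (a' *+ k); split=> //; rewrite ctens_qfracM.
Qed.

Lemma tens_exact_mid : exact_at ti tp.
Proof.
move=> y; split=> [|[x ->]]; last first.
  have [n [a [n0 ->]]] := ctens_surj x.
  by rewrite !ctens_natural pi0 raddf0.
have [n [a [n0 ->]]] := ctens_surj y; rewrite ctens_natural.
move=> /(ctens_qfrac_eq0 n0)[c'' /asboolP[k [k0 ack]]].
have [c cc] := coinv_map_surj c''.
(* Multiplying by [k] removes the torsion defect, so a multiple of [a], corrected by [c], comes from
   [b]; the denominator [n * k] compensates. *)
have /coinv_exact[b ab] : p (a *+ k - c *+ (n * k)) = 0.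
  by rewrite raddfB 2!raddfMn -cc mulrnA -mulrnBl ack.
exists (ctens _ (qfrac (n * k)) b); rewrite ctens_natural -ab raddfB.
by rewrite ctens_qfrac_kill ?muln_gt0 ?n0 // subr0 ctens_qfracM.
Qed.

Lemma tens_exact_quo y : exists x, y = tp x.
Proof.
have [n [a [n0 ->]]] := ctens_surj y; have [b ->] := coinv_map_surj a.
by exists (ctens _ (qfrac n) b); rewrite ctens_natural.
Qed.

End TensorSequence.

(** * Naturality at the end of the sequence, and functoriality of the terms *)

Section CoinvariantsNatural.
Variables (G H : finGroupType) (phi : {multiplicative G -> H}).

Lemma coinv_square (A B : gmod G) (C D : gmod H) (f : glin A B) (h : glin C D)
    (u : gmor phi A C) (v : gmor phi B D) x :
  (forall a, v (f a) = h (u a)) ->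
  coinv_map v (coinv_map f x) = coinv_map h (coinv_map u x).
Proof.
by move=> vf; have [a ->] := zpi_surj x; rewrite !coinv_mapE vf.
Qed.

Lemma coinv_tensQZ_square (A B : gmod G) (C D : gmod H) (f : glin A B)
    (h : glin C D) (u : gmor phi A C) (v : gmor phi B D) x :
  (forall a, v (f a) = h (u a)) ->
  coinv_map (tensQZ_map v) (coinv_map (tensQZ_map f) x) =
  coinv_map (tensQZ_map h) (coinv_map (tensQZ_map u) x).
Proof.
move=> vf; have [n [a [_ ->]]] := ctens_surj x.
by rewrite !ctens_natural (coinv_square _ vf).
Qed.

Lemma conn_tens_natural (S : ses G) (T : ses H) (F : ses_mor phi S T) x :
  coinv_map (tensQZ_map (mor_sub F)) (conn_tens S x) =
  conn_tens T (ctors_map (mor_quo F) x).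
Proof.
have /conn_tensP[n [a [a' [n0 xa aa' ->]]]] := erefl (conn_tens S x).
apply/conn_tensP; exists n, (coinv_map (mor_mid F) a), (coinv_map (mor_sub F) a').
split; rewrite ?ctens_natural //= ?xa.
  exact/coinv_square/mor_proj.
by rewrite -(coinv_square _ (mor_inj F)) aa' raddfMn.
Qed.

End CoinvariantsNatural.

Lemma Hmap_functor m : functor_laws (fun G A => Hgrp A m) (fun G H phi A C f => Hmap f m).
Proof.
split=> [G A x|G H K phi psi A C D f h x]; have [z ->] := zpi_surj x; rewrite !HmapE.
  congr zpi; apply: val_inj; apply/ffunP => t.
  exact: (chain_map_glinE (gmor_id A)).
congr zpi; apply: val_inj; apply/ffunP => t; rewrite /= !ffunE.
under [RHS]eq_bigr => s _ do rewrite ffunE raddf_sum.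
rewrite (sum_fiber (@simplex_map _ _ phi m) (fun s => simplex_map psi s == t)).
apply: eq_bigl => g; congr (_ == _).
by apply/ffunP => k; rewrite !ffunE.
Qed.

Lemma coinv_functor :
  functor_laws (fun G A => coinv A) (fun G H phi A C f => coinv_map f).
Proof.
split=> [G A x|G H K phi psi A C D f h x]; have [a ->] := zpi_surj x.
  by rewrite coinv_mapE.
by rewrite !coinv_mapE.
Qed.

Lemma ctors_functor :
  functor_laws (fun G A => ctors A) (fun G H phi A C f => ctors_map f).
Proof.
have [coinv_id coinv_comp] := coinv_functor.
split=> [G A x|G H K phi psi A C D f h x]; apply: val_inj; first exact: coinv_id.
exact: coinv_comp.
Qed.

Lemma coinv_tensQZ_functor :
  functor_laws (fun G A => coinv (tensQZ A)) (fun G H phi A C f => coinv_map (tensQZ_map f)).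
Proof.
have [coinv_id coinv_comp] := coinv_functor.
split=> [G A x|G H K phi psi A C D f h x]; have [n [a [_ ->]]] := ctens_surj x.
  by rewrite ctens_natural coinv_id.
by rewrite !ctens_natural coinv_comp.
Qed.

Theorem theoremA1 :
  exists d : forall (G : finGroupType) (S : ses G), connecting S,
    (forall (G : finGroupType) (S : ses G), long_exact (d G S)) /\
    (forall (G H : finGroupType) (phi : {multiplicative G -> H})
        (S : ses G) (T : ses H) (F : ses_mor phi S T),
      ladder F (d G S) (d H T)) /\
    (forall m : nat,
      functor_laws (fun G A => Hgrp A m.+1)
        (fun G H phi A C f => Hmap f m.+1)) /\
    functor_laws (fun G A => ctors A) (fun G H phi A C f => ctors_map f) /\
    functor_laws (fun G A => coinv (tensQZ A))
      (fun G H phi A C f => coinv_map (tensQZ_map f)).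
Proof.
(* The index shifts by one because [conn_hom] in degree 0 enters through [conn_ctors]. *)
exists (fun G S => Connecting (fun m => conn_hom S m.+1) (conn_ctors S) (conn_tens S)).
split; last split; last split; last split.
- move=> G S; split=> /=.
  + by move=> m; apply: Hmap_exact_sub.
  + by move=> m; apply: Hmap_exact_mid.
  + by move=> m; apply: Hmap_exact_quo.
  + exact: conn_ctors_exact_quo.
  + exact: conn_ctors_exact_sub.
  + exact: ctors_exact_mid.
  + exact: conn_tens_exact_quo.
  + exact: conn_tens_exact_sub.
  + exact: tens_exact_mid.
  + exact: tens_exact_quo.
- move=> G H phi S T F; split=> /=.
  + by move=> m x; apply/Hmap_square/mor_inj.
  + by move=> m x; apply/Hmap_square/mor_proj.
  + by move=> m x; apply: conn_hom_natural.
  + exact: conn_ctors_natural.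
  + by move=> x; apply: val_inj; apply/coinv_square/mor_inj.
  + by move=> x; apply: val_inj; apply/coinv_square/mor_proj.
  + exact: conn_tens_natural.
  + by move=> x; apply/coinv_tensQZ_square/mor_inj.
  + by move=> x; apply/coinv_tensQZ_square/mor_proj.
- by move=> m; apply: Hmap_functor.
- exact: ctors_functor.
- exact: coinv_tensQZ_functor.
Qed.
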